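(* Let $\overline{\mathcal D}=(\overline X,\overline{\mathcal B},\overline\rho)$ be a $t$-divisible design with $\overline X\subset X$, $X$ finite, and let $G$ be a group acting on $X$ such that conditions (a)–(e) below hold; let $\mathcal D=(X,\mathcal B,\rho)$ be the resulting $t$-lifting, i.e. $\mathcal B=\{\overline B^g\mid\overline B\in\overline{\mathcal B},g\in G\}$ and $\rho=\{(x,x')\mid(\widehat x,\widehat x')\in\overline\rho\}$. Conditions: (a) for each $x\in X$ there is a unique $\widehat x\in\overline X$ with $x^G=\widehat x^G$; (b) all orbits $\overline x^G$, $\overline x\in\overline X$, have the same size; (c) for any $Y=\{y_1,\dots,y_t\}\subseteq X$ such that $\widehat Y=\{\widehat y_1,\dots,\widehat y_t\}$ is a $\overline\rho$-transversal $t$-subset of $\overline X$, some $g\in G$ satisfies $Y^g=\widehat Y$; (d) all setwise stabilizers $G_{\overline Y}$ of $\overline\rho$-transversal $t$-subsets $\overline Y\subseteq\overline X$ have the same size; (e) all setwise stabilizers $G_{\overline B}$, $\overline B\in\overline{\mathcal B}$, have the same size. Assume that there is a group $\overline H$ of automorphisms of $\overline{\mathcal D}$ which acts transitively on $\overline{\mathcal B}$ and transitively on the set of $\overline\rho$-transversal $t$-subsets of $\overline X$. If each $\overline h\in\overline H$ can be extended to an automorphism of $\mathcal D$, then $\mathcal D$ admits a group of automorphisms which acts transitively on $\mathcal B$ and transitively on the set of $\rho$-transversal $t$-subsets of $X$. Hence $\mathcal D$ can also be obtained with Spera's construction.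
   Context: A $t$-divisible design $(X,\mathcal B,\rho)$: $X$ finite set, $\rho$ an equivalence relation on $X$ (classes = point classes), a subset is $\rho$-transversal if it meets each point class in at most one point; there are positive integers $s,k,\lambda_t$ such that every block in $\mathcal B$ is a $\rho$-transversal $k$-subset, every point class has size $s$, every $\rho$-transversal $t$-subset lies in exactly $\lambda_t$ blocks, and $t\le \#X/s$. Under the hypotheses (a)–(e), $(X,\mathcal B,\rho)$ is again a $t$-divisible design, called the $t$-lifting of $\overline{\mathcal D}$ under $G$. An automorphism of a divisible design is a permutation of its point set mapping blocks onto blocks and point classes onto point classes. Spera's construction (A. G. Spera, 1992) produces a $t$-divisible design from a point set with equivalence relation, a group acting on it and a base block (the blocks being the orbit of the base block); a $t$-divisible design can be obtained by Spera's construction if and only if it admits a group of automorphisms acting transitively on the blocks and transitively on the transversal $t$-subsets of points. *)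

(* Defs.v *)
(* The classical layer of MathComp-Analysis serves possibly infinite acting
   groups, whose orbits cannot be decided by enumeration. *)
From mathcomp Require Import all_boot all_fingroup.
From mathcomp Require Import boolp classical_sets cardinality.

Set Implicit Arguments.
Unset Strict Implicit.
Unset Printing Implicit Defensive.

Local Open Scope group_scope.

(* A triple (X, B, rho) inside an ambient finite type. The values of [parallel]
   outside [points] are junk and are never used. *)
Record incidence (T : finType) := Incidence {
  points : {set T};
  blocks : {set {set T}};
  parallel : rel T
}.

Section Design.

Variable T : finType.
Implicit Types (D : incidence T) (Y : {set T}) (t : nat).

Definition point_classes D : {set {set T}} :=
  equivalence_partition (parallel D) (points D).

Definition rho_transversal D Y : bool :=
  (Y \subset points D) && [forall C in point_classes D, #|Y :&: C| <= 1].

Definition rho_transversals D t : {set {set T}} :=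
  [set Y : {set T} | rho_transversal D Y & #|Y| == t].

Definition divisible_design t D : Prop :=
  {in points D & &, equivalence_rel (parallel D)} /\
  exists s k lambda : nat,
    [/\ [/\ 0 < s, 0 < k & 0 < lambda],
        {in blocks D, forall B : {set T}, rho_transversal D B /\ #|B| = k},
        {in point_classes D, forall C : {set T}, #|C| = s},
        {in rho_transversals D t, forall Y : {set T},
          #|[set B in blocks D | Y \subset B]| = lambda}
      & t <= #|points D| %/ s].

(* Permutations of the point set are permutations of [T] supported on it.
   By finiteness, stabilising the set of blocks (resp. of point classes) is the
   same as mapping it onto itself. *)
Definition automorphisms D : {set {perm T}} :=
  'N_(Sym (points D))(blocks D | 'P^* ) :&: 'N(point_classes D | 'P^* ).

(* Spera's construction: the group [A] respects the equivalence relation and is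
   transitive on the transversal t-subsets; [B0] is the base block. An arbitrary
   group acting on the points may be replaced by the permutation group that it
   induces. *)
Definition spera_construction t D (A : {group {perm T}}) (B0 : {set T}) : Prop :=
  [/\ {in points D & &, equivalence_rel (parallel D)} /\
        (exists2 s, 0 < s & {in point_classes D, forall C : {set T}, #|C| = s}),
      A \subset Sym (points D) /\
        {in A, forall a : {perm T}, {in points D &, forall x y,
           parallel D x y -> parallel D (a x) (a y)}},
      [transitive A, on rho_transversals D t | 'P^* ],
      [/\ rho_transversal D B0, 0 < #|B0| & t <= #|B0|]
    & blocks D = orbit 'P^* A B0].

Definition obtained_by_spera t D : Prop :=
  exists (A : {group {perm T}}) (B0 : {set T}), spera_construction t D A B0.

End Design.

(* Right actions of an arbitrary, possibly infinite, group on [T]; the actions of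
   the finite group library require a finite acting group. *)
Definition right_action (T : finType) (gT : groupType) (to : T -> gT -> T) : Prop :=
  (forall x, to x 1 = x) /\ (forall x g h, to x (g * h) = to (to x g) h).

Section Lifting.

Variables (T : finType) (gT : groupType) (to : T -> gT -> T).
Implicit Types (x y : T) (Y : {set T}) (D : incidence T) (t : nat).

Definition gorbit x : {set T} := [set y | `[< exists g, y = to x g >]].

Definition gset Y (g : gT) : {set T} := [set to y g | y in Y].

Definition gstab Y : set gT := fun g => gset Y g = Y.

(* Meaningful under [lift_cond_a], which makes the representative unique. *)
Definition hat D x : T := odflt x [pick y in points D | gorbit x == gorbit y].

Definition lift_cond_a D : Prop :=
  forall x, exists! y, y \in points D /\ gorbit x = gorbit y.

Definition lift_cond_b D : Prop :=
  {in points D &, forall x y, #|gorbit x| = #|gorbit y|}.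

Definition lift_cond_c t D : Prop :=
  forall Y, #|Y| = t -> hat D @: Y \in rho_transversals D t ->
    exists g, gset Y g = hat D @: Y.

(* [card_eq] is equipotence, i.e. equality of sizes also for infinite groups. *)
Definition lift_cond_d t D : Prop :=
  {in rho_transversals D t &, forall Y Z, card_eq (gstab Y) (gstab Z)}.

Definition lift_cond_e D : Prop :=
  {in blocks D &, forall B C, card_eq (gstab B) (gstab C)}.

Definition lifting D : incidence T :=
  {| points := [set: T];
     blocks := [set C : {set T} |
                 `[< exists B g, B \in blocks D /\ C = gset B g >]];
     parallel := fun x y => parallel D (hat D x) (hat D y) |}.

End Lifting.

(* Main.v *)
Require Import Defs.
From mathcomp Require Import all_boot all_fingroup.
From mathcomp Require boolp.

Set Implicit Arguments.
Unset Strict Implicit.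
Unset Printing Implicit Defensive.

(** The group of all automorphisms of the lifting works.  It contains the
    permutations induced by [G], which carry every block and (by condition (c))
    every transversal t-subset to one of the original design; there the
    extensions of the elements of [Hbar] finish the job. *)

Local Open Scope group_scope.

(** * Point classes, transversal sets and automorphisms in terms of [parallel] *)

Section IncidenceAutomorphisms.

Variables (T : finType) (D : incidence T).

Lemma point_classesP (C : {set T}) :
  reflect (exists2 x, x \in points D & C = [set y in points D | parallel D x y])
          (C \in point_classes D).
Proof. exact: imsetP. Qed.

Hypothesis eqD : {in points D & &, equivalence_rel (parallel D)}.

Lemma parallel_refl x : x \in points D -> parallel D x x.
Proof. by move=> Dx; have [] := eqD Dx Dx Dx. Qed.

Lemma parallelE x y z : x \in points D -> y \in points D -> z \in points D ->
  parallel D x y -> parallel D x z = parallel D y z.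
Proof. by move=> Dx Dy Dz; have [_] := eqD Dx Dy Dz; apply. Qed.

Lemma parallel_classP x y : x \in points D -> y \in points D ->
  reflect (exists C, [/\ C \in point_classes D, x \in C & y \in C])
          (parallel D x y).
Proof.
move=> Dx Dy; apply: (iffP idP) => [xy | [_ [/point_classesP[z Dz ->]]]].
  exists [set y in points D | parallel D x y]; rewrite !inE Dx Dy xy.
  by rewrite parallel_refl //; split=> //; apply/point_classesP; exists x.
by rewrite !inE => /andP[_ zx] /andP[_ zy]; rewrite -(parallelE Dz).
Qed.

(** Trades the count over classes for a condition on pairs of points, the form that transports along
    permutations and along [hat]. *)
Lemma rho_transversalP (Y : {set T}) :
  reflect (Y \subset points D /\ {in Y &, forall x y, parallel D x y -> x = y})
          (rho_transversal D Y).
Proof.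
apply: (iffP andP) => [[sY /forallP tY] | [sY tY]]; split=> //.
  move=> x y Yx Yy /parallel_classP[]; rewrite ?(subsetP sY) // => C [CC Cx Cy].
  have /implyP/(_ CC)/card_le1_eqP := tY C.
  by apply; rewrite inE ?Yx ?Yy.
apply/forallP => C; apply/implyP => CC; apply/card_le1_eqP => x y.
rewrite !inE => /andP[Yx Cx] /andP[Yy Cy]; apply: tY => //.
by apply/parallel_classP; rewrite ?(subsetP sY) //; exists C.
Qed.

Lemma automorphismsP (a : {perm T}) :
  reflect [/\ a \in Sym (points D),
              forall B, B \in blocks D -> a @: B \in blocks D
            & forall C, C \in point_classes D -> a @: C \in point_classes D]
          (a \in automorphisms D).
Proof.
rewrite in_setI in_setI -andbA.
apply: (iffP and3P) => [[Sa aB aC] | [Sa aB aC]]; split=> //.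
- by move=> B BB; move: (astabs_act B aB); rewrite BB.
- by move=> C CC; move: (astabs_act C aC); rewrite CC.
- by rewrite !inE; apply/subsetP=> B /aB; rewrite inE.
- by rewrite !inE; apply/subsetP=> C /aC; rewrite inE.
Qed.

Lemma automorphism_points (a : {perm T}) x :
  a \in automorphisms D -> (a x \in points D) = (x \in points D).
Proof. by case/automorphismsP; rewrite inE => Sa _ _; apply: perm_closed. Qed.

Lemma automorphism_parallel (a : {perm T}) :
  a \in automorphisms D ->
  {in points D &, forall x y, parallel D x y -> parallel D (a x) (a y)}.
Proof.
move=> Aa x y Dx Dy; have [_ _ aC] := automorphismsP _ Aa.
case/parallel_classP=> // C [CC Cx Cy].
apply/parallel_classP; rewrite ?automorphism_points //.
by exists (a @: C); split; [apply: aC | apply: imset_f | apply: imset_f].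
Qed.

Lemma automorphism_transversals t (a : {perm T}) (Y : {set T}) :
  a \in automorphisms D -> Y \in rho_transversals D t ->
  a @: Y \in rho_transversals D t.
Proof.
(* Parallelism of two image points is pulled back to [Y] along the inverse automorphism. *)
move=> Aa; have AVa : a^-1 \in automorphisms D by rewrite groupV.
rewrite !inE (card_imset _ (@perm_inj _ a)) => /andP[/rho_transversalP[sY tY] ->].
rewrite andbT; apply/rho_transversalP; split=> [|_ _ /imsetP[x Yx ->] /imsetP[y Yy ->]].
  by apply/subsetP=> _ /imsetP[x Yx ->]; rewrite automorphism_points ?(subsetP sY).
have Dx := subsetP sY x Yx; have Dy := subsetP sY y Yy.
move/(automorphism_parallel AVa); rewrite !permK !automorphism_points //.
by move=> axy; congr (a _); apply: tY => //; apply: axy.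
Qed.

End IncidenceAutomorphisms.

(** Transitivity means that [S] is the orbit of one of its members: reaching everything from [Y0]
    gives one inclusion, invariance of [S] the other. *)
Lemma setact_transitive (T : finType) (A : {group {perm T}})
    (S : {set {set T}}) (Y0 : {set T}) :
    Y0 \in S ->
    {in A, forall a : {perm T}, {in S, forall Y : {set T}, a @: Y \in S}} ->
    {in S, forall Y : {set T}, exists2 a : {perm T}, a \in A & Y = a @: Y0} ->
  [transitive A, on S | 'P^* ].
Proof.
move=> SY0 AS Atr; apply/imsetP; exists Y0 => //.
apply/setP=> Y; apply/idP/orbitP => [/Atr[a Aa ->] | [a Aa <-]].
  by exists a.
exact: AS.
Qed.

Lemma setact_transitiveP (T : finType) (A : {group {perm T}})
    (S : {set {set T}}) (Y Z : {set T}) :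
    [transitive A, on S | 'P^* ] -> Y \in S -> Z \in S ->
  exists2 a : {perm T}, a \in A & Z = a @: Y.
Proof. by move=> trA SY SZ; have [a Aa ->] := atransP2 trA SY SZ; exists a. Qed.

(** * Orbits, their representatives, and the permutations induced by the action *)

Section Lifting.

Variables (T : finType) (gT : groupType) (to : T -> gT -> T) (D : incidence T).
Hypothesis to_act : right_action to.

Let to1 : forall x, to x 1 = x := proj1 to_act.
Let toM : forall x g h, to x (g * h) = to (to x g) h := proj2 to_act.

Lemma right_action_inj (g : gT) : injective (to^~ g).
Proof. by apply: (can_inj (g := to^~ g^-1)) => x; rewrite -toM mulgV to1. Qed.

(** The acting group may be infinite; the permutation induced by [g] lives in a finite group and can
    be multiplied with extensions of elements of [Hbar]. *)
Definition act_perm (g : gT) : {perm T} := perm (@right_action_inj g).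

Lemma act_permE g x : act_perm g x = to x g.
Proof. by rewrite permE. Qed.

Lemma gsetE (Y : {set T}) g : gset to Y g = act_perm g @: Y.
Proof. by apply: eq_imset => x; rewrite act_permE. Qed.

Lemma gsetM (Y : {set T}) g h : gset to (gset to Y g) h = gset to Y (g * h).
Proof. by rewrite /gset -imset_comp; apply: eq_imset => x /=; rewrite toM. Qed.

Lemma gorbitP x y : reflect (exists g, y = to x g) (y \in gorbit to x).
Proof. by rewrite inE; apply: boolp.asboolP. Qed.

Lemma gorbit_refl x : x \in gorbit to x.
Proof. by apply/gorbitP; exists 1; rewrite to1. Qed.

Lemma gorbit_to x g : gorbit to (to x g) = gorbit to x.
Proof.
apply/setP=> y; apply/gorbitP/gorbitP=> -[h ->].
  by exists (g * h); rewrite toM.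
by exists (g^-1 * h); rewrite -toM mulgA mulgV mul1g.
Qed.

Hypothesis condA : lift_cond_a to D.

Lemma hatP x : hat to D x \in points D /\ gorbit to x = gorbit to (hat to D x).
Proof.
(* Condition (a) rules out a failed search, so the default value of [hat] never occurs. *)
rewrite /hat; case: pickP => [y /andP[Dy /eqP] // | no].
by have [y [[Dy oxy] _]] := condA x; move: (no y); rewrite Dy oxy eqxx.
Qed.

Lemma hat_points x : hat to D x \in points D.
Proof. by case: (hatP x). Qed.

Lemma hat_eq x y : y \in points D -> gorbit to x = gorbit to y -> hat to D x = y.
Proof.
move=> Dy oxy; have [z [_ Uz]] := condA x; have hx := hatP x.
by rewrite -(Uz _ hx) -(Uz y).
Qed.

Lemma hat_id x : x \in points D -> hat to D x = x.
Proof. by move/hat_eq; apply. Qed.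

Lemma hat_to x g : hat to D (to x g) = hat to D x.
Proof. by apply: hat_eq; rewrite ?hat_points ?gorbit_to; case: (hatP x). Qed.

(** Lets the points of a lifted class be counted orbit by orbit. *)
Lemma hat_fiber x : x \in points D -> [set y | hat to D y == x] = gorbit to x.
Proof.
move=> Dx; apply/setP=> y; rewrite inE; apply/eqP/gorbitP=> [<- | [g ->]].
  by apply/gorbitP; have [_ <-] := hatP y; apply: gorbit_refl.
by rewrite hat_to hat_id.
Qed.

(** * Blocks, point classes and transversal sets of the lifting *)

Lemma lifting_blocksP (C : {set T}) :
  reflect (exists B g, B \in blocks D /\ C = gset to B g)
          (C \in blocks (lifting to D)).
Proof. by rewrite inE; apply: boolp.asboolP. Qed.

Lemma blocks_lifting B : B \in blocks D -> B \in blocks (lifting to D).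
Proof.
move=> DB; apply/lifting_blocksP; exists B, 1; split=> //.
by rewrite -[LHS]imset_id; apply: eq_imset => x; rewrite to1.
Qed.

(** Translating a translate of a block gives another translate; and since [hat] is constant on
    orbits, each point class of the lifting is even mapped onto itself. *)
Lemma act_perm_automorphism g : act_perm g \in automorphisms (lifting to D).
Proof.
apply/automorphismsP; split=> [|B|C].
- by rewrite inE; apply/subsetP=> x _; rewrite inE.
- case/lifting_blocksP=> B0 [h [DB0 ->]]; apply/lifting_blocksP.
  by exists B0, (h * g); rewrite -gsetE gsetM.
case/point_classesP=> x _ ->; apply/point_classesP; exists x; rewrite ?inE //.
(* With [y] written as the image of its preimage, it remains to compare a point with its translate,
   and these share the same [hat]. *)
apply/setP=> y; rewrite -[y in LHS](permKV (act_perm g)).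
rewrite (mem_imset _ _ (@perm_inj _ _)) !inE /=.
by rewrite -[y in RHS](permKV (act_perm g)) act_permE hat_to.
Qed.

Hypothesis eqD : {in points D & &, equivalence_rel (parallel D)}.

Lemma lifting_equivalence :
  {in points (lifting to D) & &, equivalence_rel (parallel (lifting to D))}.
Proof. by move=> x y z _ _ _; apply: eqD; apply: hat_points. Qed.

(** The relation of the lifting restricts to that of [D], because [hat] fixes the points of [D]. *)
Lemma rho_transversal_lifting (Y : {set T}) :
  rho_transversal D Y -> rho_transversal (lifting to D) Y.
Proof.
case/(rho_transversalP eqD) => /subsetP sY tY.
apply/(rho_transversalP lifting_equivalence); split=> [|x y Yx Yy].
  exact: subsetT.
by rewrite /= !hat_id ?sY //; apply: tY.
Qed.

Lemma hat_transversals t (Y : {set T}) :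
  Y \in rho_transversals (lifting to D) t ->
  hat to D @: Y \in rho_transversals D t.
Proof.
rewrite !inE => /andP[/(rho_transversalP lifting_equivalence)[_ tY] /eqP <-].
(* [hat] is injective on [Y]: points with equal [hat] are parallel in the lifting, hence equal by
   transversality. *)
rewrite card_in_imset => [|x y Yx Yy hxy]; last first.
  by apply: tY; rewrite //= hxy (parallel_refl eqD) ?hat_points.
rewrite eqxx andbT; apply/(rho_transversalP eqD); split.
  by apply/subsetP=> _ /imsetP[x _ ->]; apply: hat_points.
by move=> _ _ /imsetP[x Yx ->] /imsetP[y Yy ->] /(tY _ _ Yx Yy) ->.
Qed.

(** A class of the lifting is the preimage under [hat] of a class of [D]; it splits into [s] fibres,
    each an orbit of size [m]. *)
Lemma card_lifting_class s m :
    {in point_classes D, forall C : {set T}, #|C| = s} ->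
    {in points D, forall x, #|gorbit to x| = m} ->
  {in point_classes (lifting to D), forall C : {set T}, #|C| = (s * m)%N}.
Proof.
move=> sizeD orbD _ /point_classesP[x _ ->].
set Cx := [set y in points D | parallel D (hat to D x) y].
have <- : #|Cx| = s.
  by apply: sizeD; apply/point_classesP; exists (hat to D x); rewrite ?hat_points.
rewrite -sum1_card (partition_big (hat to D) (mem Cx)) /=; last first.
  by move=> y; rewrite !inE hat_points.
rewrite -sum_nat_const; apply: eq_bigr => z; rewrite inE => /andP[Dz xz].
rewrite -(orbD z Dz) -hat_fiber // -sum1_card; apply: eq_bigl => y.
by rewrite !inE /= andbC; case: eqP => // ->.
Qed.

(** * Transitivity of the automorphism group of the lifting *)

Section Extension.

Variable Hbar : {group {perm T}}.
Hypothesis extH : forall h : {perm T}, h \in Hbar ->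
  exists2 a : {perm T}, a \in automorphisms (lifting to D) &
    {in points D, forall x, a x = h x}.

Lemma extend_imset (h : {perm T}) (Y : {set T}) :
    h \in Hbar -> Y \subset points D ->
  exists2 a : {perm T}, a \in automorphisms (lifting to D) & a @: Y = h @: Y.
Proof.
move=> /extH[a Aa ah] /subsetP sY; exists a => //.
by apply: eq_in_imset => x /sY/ah.
Qed.

Lemma lifting_block_transitive :
    {in blocks D, forall B : {set T}, B \subset points D} ->
    [transitive Hbar, on blocks D | 'P^* ] ->
  [transitive automorphisms (lifting to D), on blocks (lifting to D) | 'P^* ].
Proof.
move=> sB trH; have /imsetP[B0 DB0 _] := trH.
apply: (@setact_transitive _ _ _ B0) => [|a Aa B LB|].
- exact: blocks_lifting.
- by have [_ aB _] := automorphismsP _ _ Aa; apply: aB.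
move=> _ /lifting_blocksP[B [g [DB ->]]].
have [h Hh ->] := setact_transitiveP trH DB0 DB.
have [a Aa <-] := extend_imset Hh (sB _ DB0).
(* Products of permutations act from left to right: first [a] takes [B0] to [B], then [g] takes [B]
   to its translate. *)
exists (a * act_perm g); first by rewrite groupM ?act_perm_automorphism.
by rewrite gsetE -imset_comp; apply: eq_imset => x; rewrite /= permM.
Qed.

Lemma lifting_transversal_transitive t :
    lift_cond_c to t D ->
    [transitive Hbar, on rho_transversals D t | 'P^* ] ->
  [transitive automorphisms (lifting to D),
     on rho_transversals (lifting to D) t | 'P^* ].
Proof.
move=> condC trH; have /imsetP[Y0 DY0 _] := trH.
have /andP[TY0 cY0] : rho_transversal D Y0 && (#|Y0| == t) by rewrite inE in DY0.
have [sY0 _] := rho_transversalP eqD _ TY0.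
apply: (@setact_transitive _ _ _ Y0) => [|a Aa Y LY|Y LY].
- by rewrite inE rho_transversal_lifting.
- exact: (automorphism_transversals lifting_equivalence).
have DhY := hat_transversals LY.
(* Condition (c) moves [Y] onto its projection, which the extension of some [h] reaches from [Y0];
   undoing [g] then leads back to [Y]. *)
have [g gY] : exists g, gset to Y g = hat to D @: Y.
  by apply: condC => //; move: LY; rewrite inE => /andP[_ /eqP].
have [h Hh hY0] := setact_transitiveP trH DY0 DhY.
have [a Aa ahY0] := extend_imset Hh sY0.
exists (a * (act_perm g)^-1).
  by rewrite groupM // groupV act_perm_automorphism.
have -> : (a * (act_perm g)^-1) @: Y0 = (act_perm g)^-1 @: (a @: Y0).
  by rewrite -imset_comp; apply: eq_imset => x; rewrite /= permM.
rewrite ahY0 -hY0 -gY gsetE -imset_comp -[LHS]imset_id.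
by apply: eq_imset => x; rewrite /= permK.
Qed.

End Extension.

End Lifting.

Theorem theorem2p6 (T : finType) (gT : groupType) (to : T -> gT -> T) (t : nat)
    (Dbar : incidence T) (Hbar : {group {perm T}}) :
  right_action to ->
  divisible_design t Dbar ->
  lift_cond_a to Dbar ->
  lift_cond_b to Dbar ->
  lift_cond_c to t Dbar ->
  lift_cond_d to t Dbar ->
  lift_cond_e to Dbar ->
  Hbar \subset automorphisms Dbar ->
  [transitive Hbar, on blocks Dbar | 'P^* ] ->
  [transitive Hbar, on rho_transversals Dbar t | 'P^* ] ->
  (forall h : {perm T}, h \in Hbar ->
     exists2 a : {perm T}, a \in automorphisms (lifting to Dbar) &
       {in points Dbar, forall x, a x = h x}) ->
  (exists H : {group {perm T}},
     [/\ H \subset automorphisms (lifting to Dbar),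
         [transitive H, on blocks (lifting to Dbar) | 'P^* ]
       & [transitive H, on rho_transversals (lifting to Dbar) t | 'P^* ]]) /\
  obtained_by_spera t (lifting to Dbar).
Proof.
move=> to_act [eqD [s [k [l [[s0 k0 l0] blockD classD lamD _]]]]].
move=> condA condB condC _ _ _ trB trY extH.
have sB : {in blocks Dbar, forall B : {set T}, B \subset points Dbar}.
  by move=> B /blockD[/andP[]].
have trLB := lifting_block_transitive to_act condA extH sB trB.
have trLY := lifting_transversal_transitive to_act condA eqD extH condC trY.
have eqL := lifting_equivalence condA eqD.
split; first by exists [group of automorphisms (lifting to Dbar)].
(* The base block is chosen through a transversal t-subset [Y0], possible as [l] is positive;
   containing [Y0] gives it the at least [t] points that Spera's construction demands. *)
have /imsetP[Y0 DY0 _] := trY.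
have [B] : exists B, B \in [set B in blocks Dbar | Y0 \subset B].
  by apply/set0Pn; rewrite -card_gt0 (lamD _ DY0).
rewrite inE => /andP[DB Y0B]; have [TB cB] := blockD _ DB.
have [x Bx] : exists x, x \in B by apply/set0Pn; rewrite -card_gt0 cB.
have Dx := subsetP (sB _ DB) x Bx.
exists [group of automorphisms (lifting to Dbar)], B; split=> //.
(* By condition (b) the orbit of the single point [x] of [B] gives the common orbit size. *)
- split=> //; exists (s * #|gorbit to x|)%N.
    by rewrite muln_gt0 s0 card_gt0; apply/set0Pn; exists x; apply: gorbit_refl.
  by apply: card_lifting_class => // y Dy; apply: condB.
- split=> [|a Aa]; first by apply/subsetP=> a /automorphismsP[].
  exact: automorphism_parallel.
- split; first exact: rho_transversal_lifting.
    by rewrite cB.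
  by move: DY0; rewrite inE => /andP[_ /eqP <-]; apply: subset_leq_card.
(* Block transitivity says exactly that the blocks of the lifting form the orbit of [B]. *)
by rewrite (atransP trLB B (blocks_lifting to_act DB)).
Qed.
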